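(* Let $(P,g,\Phi)$ be a Carrollian $\mathbb{R}^\times$-bundle with a connection, and let $\omega$ be the connection one-form of $\Phi$. Then $g^{(+)}_\omega:=g+\omega^2$ and $g^{(-)}_\omega:=g-\omega^2$ are non-degenerate metrics on $P$, where $\omega^2=\omega\otimes\omega$.
   Context: $\mathbb{R}^\times:=\mathbb{R}\setminus\{0\}$ with multiplication. A principal $\mathbb{R}^\times$-bundle $\pi:P\to M$ is a line bundle over $M$ with its zero section removed, with $\mathbb{R}^\times$ acting by fibrewise multiplication $\mathrm{h}_s$; adapted local coordinates are $(x^a,t)$, $t\neq0$. The Euler vector field $\Delta_P$ is the fundamental vector field of the action, locally $\Delta_P=t\,\partial_t$; it globally generates the module $\mathrm{Sec}(VP)$ of vertical vector fields, $VP=\ker(d\pi)$. A Carrollian $\mathbb{R}^\times$-bundle is a pair $(P,g)$, where $P$ is a principal $\mathbb{R}^\times$-bundle and $g$ is a degenerate metric (smooth symmetric covariant 2-tensor) on the total space $P$ with $\{X\in\mathrm{Vect}(P): g(X,-)=0\}=\mathrm{Sec}(VP)$, understood pointwise: $\ker(g_p)=V_pP$ for all $p\in P$. An $\mathbb{R}^\times$-connection on $P$ is a smooth vector bundle map $\Phi:TP\to TP$ over $P$ with $\Phi\circ\Phi=\Phi$, $\mathrm{Im}\,\Phi=VP$, and $(T\mathrm{h}_s)\circ\Phi=\Phi\circ(T\mathrm{h}_s)$ for all $s\in\mathbb{R}^\times$. Its connection one-form $\omega$ is the real-valued one-form on $P$ defined by $\Phi(X)=\omega(X)\Delta_P$ for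 all $X\in\mathrm{Vect}(P)$. A Carrollian $\mathbb{R}^\times$-bundle with a connection is a triple $(P,g,\Phi)$ with $(P,g)$ a Carrollian $\mathbb{R}^\times$-bundle and $\Phi$ an $\mathbb{R}^\times$-connection on $P$. *)

(* Defs.v *)
From HB Require Import structures.
From mathcomp Require Import all_boot all_order all_algebra.
From mathcomp Require Import all_classical all_reals all_analysis.

Set Implicit Arguments.
Unset Strict Implicit.
Unset Printing Implicit Defensive.

Import Order.TTheory GRing.Theory Num.Theory.
Import numFieldNormedType.Exports.

Local Open Scope classical_set_scope.
Local Open Scope ring_scope.

Section EuclideanSmoothness.
Context {R : realType} {n : nat}.
Implicit Types (f g : 'rV[R]_n -> R) (x y : 'rV[R]_n) (U : set 'rV[R]_n).
Implicit Types (s : seq 'I_n) (k : nat).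

Definition partial f (i : 'I_n) : 'rV[R]_n -> R :=
  fun x => 'D_(delta_mx 0 i) f x.

Definition iter_partial f s : 'rV[R]_n -> R := foldl partial f s.

Definition C0_derivable f y : Prop :=
  {for y, continuous f} /\ forall i, derivable f y (delta_mx 0 i).

(* All iterated partial derivatives exist and are continuous near x.  Only the
   germ of f at x matters, so f may be a junk-extended local function. *)
Definition Cinfty_at f x : Prop :=
  \forall y \near x, forall s, C0_derivable (iter_partial f s) y.

Definition Ck k U f := forall s, (size s <= k)%N ->
  forall y, U y -> C0_derivable (iter_partial f s) y.

Lemma CkS k U f : Ck k.+1 U f <->
  (forall y, U y -> C0_derivable f y) /\ forall i, Ck k U (partial f i).
Proof.
split=> [h|[h0 hS] [|i s] //= ss y Uy].
- split=> [y Uy|i s ss y Uy]; first exact: (h [::]).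
  exact: (h (i :: s)).
exact: (hS i s ss y Uy).
Qed.

Lemma Ck0 U f : Ck 0 U f <-> forall y, U y -> C0_derivable f y.
Proof.
by split=> [h y Uy|h [|//] _ y Uy]; [exact: (h [::])|exact: h].
Qed.

Lemma CkW k U f : Ck k.+1 U f -> Ck k U f.
Proof. by move=> h s ss; apply: h; rewrite (leq_trans ss). Qed.

Lemma near_open_eq U f g y : open U -> (forall z, U z -> f z = g z) -> U y ->
  {near y, f =1 g}.
Proof.
move=> oU fg Uy; have : nbhs y U by exact: open_nbhs_nbhs.
by apply: filterS => z; exact: fg.
Qed.

Lemma C0_derivable_ext U f g y : open U -> (forall z, U z -> f z = g z) ->
  U y -> C0_derivable f y -> C0_derivable g y.
Proof.
move=> oU fg Uy [cf df]; split=> [|i].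
  have nfg := near_open_eq oU fg Uy.
  rewrite /prop_for /continuous_at -(fg _ Uy).
  apply: (cvg_trans _ cf); exact: (@near_eq_cvg _ _ (nbhs y) _ f g nfg).
exact: near_eq_derivable (near_open_eq oU fg Uy) (df i).
Qed.

Lemma partial_ext U f g i y : open U -> (forall z, U z -> f z = g z) ->
  U y -> partial f i y = partial g i y.
Proof.
by move=> oU fg Uy; apply: near_eq_derive; exact: near_open_eq oU fg Uy.
Qed.

Lemma Ck_ext k U f g : open U -> (forall z, U z -> f z = g z) ->
  Ck k U f -> Ck k U g.
Proof.
move=> oU; elim: k f g => [|k IH] f g fg.
  by rewrite !Ck0 => h y Uy; exact: C0_derivable_ext oU fg Uy (h y Uy).
rewrite !CkS => -[h0 hS]; split=> [y Uy|i].
  exact: C0_derivable_ext oU fg Uy (h0 y Uy).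
by apply: IH (hS i) => z Uz; exact: partial_ext oU fg Uz.
Qed.

Lemma C0_derivable_cst (a : R) y : C0_derivable (fun=> a) y.
Proof. by split=> [|i]; [exact: cst_continuous|exact: derivable_cst]. Qed.

Lemma Ck_cst k U (a : R) : open U -> Ck k U (fun=> a).
Proof.
move=> oU; elim: k a => [|k IH] a.
  by rewrite Ck0 => y _; exact: C0_derivable_cst.
rewrite CkS; split=> [y _|i]; first exact: C0_derivable_cst.
apply: (Ck_ext oU _ (IH 0)) => z _; rewrite /partial.
by have -> : 'D_(delta_mx 0 i) (fun=> a) z = 0 := derive_cst a z _.
Qed.

Lemma C0_derivableD f g y : C0_derivable f y -> C0_derivable g y ->
  C0_derivable (f + g) y.
Proof.
move=> [cf df] [cg dg]; split=> [|i]; first exact: continuousD.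
exact: derivableD.
Qed.

Lemma C0_derivableM f g y : C0_derivable f y -> C0_derivable g y ->
  C0_derivable (f * g) y.
Proof.
move=> [cf df] [cg dg]; split=> [|i]; first exact: continuousM.
exact: derivableM.
Qed.

Lemma CkD k U f g : open U -> Ck k U f -> Ck k U g -> Ck k U (f + g).
Proof.
move=> oU; elim: k f g => [|k IH] f g.
  by rewrite !Ck0 => hf hg y Uy; apply: C0_derivableD; [exact: hf|exact: hg].
rewrite !CkS => -[f0 fS] [g0 gS]; split=> [y Uy|i].
  by apply: C0_derivableD; [exact: f0|exact: g0].
apply: (Ck_ext oU _ (IH _ _ (fS i) (gS i))) => z Uz.
by rewrite /partial deriveD//; [case: (f0 z Uz)|case: (g0 z Uz)].
Qed.

Lemma CkM k U f g : open U -> Ck k U f -> Ck k U g -> Ck k U (f * g).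
Proof.
move=> oU; elim: k f g => [|k IH] f g.
  by rewrite !Ck0 => hf hg y Uy; apply: C0_derivableM; [exact: hf|exact: hg].
move=> hf hg; have [fk gk] := (CkW hf, CkW hg).
move: hf hg; rewrite !CkS => -[f0 fS] [g0 gS]; split=> [y Uy|i].
  by apply: C0_derivableM; [exact: f0|exact: g0].
apply: (Ck_ext oU _ (CkD oU (IH _ _ fk (gS i)) (IH _ _ gk (fS i)))) => z Uz.
by rewrite /partial deriveM//; [case: (f0 z Uz)|case: (g0 z Uz)].
Qed.

Lemma Cinfty_atP f x :
  Cinfty_at f x <-> exists U, [/\ open U, U x & forall k, Ck k U f].
Proof.
split=> [|[U [oU Ux hU]]].
  move=> h; have : nbhs x [set y | forall s, C0_derivable (iter_partial f s) y].
    exact: h.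
  rewrite nbhsE => -[U [oU Ux] hU].
  by exists U; split=> // k s _ y Uy; exact: hU.
have : nbhs x U by exact: open_nbhs_nbhs.
by apply: filterS => y Uy s; apply: (hU (size s) s).
Qed.

Lemma Ck_sub k U V f : V `<=` U -> Ck k U f -> Ck k V f.
Proof. by move=> VU h s ss y /VU; exact: h. Qed.

Lemma Cinfty_at_cst (a : R) x : Cinfty_at (fun=> a) x.
Proof.
apply/Cinfty_atP; exists setT; split=> // [|k]; first exact: openT.
exact/Ck_cst/openT.
Qed.

Lemma Cinfty_atD f g x : Cinfty_at f x -> Cinfty_at g x -> Cinfty_at (f + g) x.
Proof.
move=> /Cinfty_atP[U [oU Ux hU]] /Cinfty_atP[V [oV Vx hV]].
apply/Cinfty_atP; exists (U `&` V); split=> // [|k]; first exact: openI.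
apply: CkD; first exact: openI.
- exact: Ck_sub (hU k).
- exact: Ck_sub (hV k).
Qed.

Lemma Cinfty_atM f g x : Cinfty_at f x -> Cinfty_at g x -> Cinfty_at (f * g) x.
Proof.
move=> /Cinfty_atP[U [oU Ux hU]] /Cinfty_atP[V [oV Vx hV]].
apply/Cinfty_atP; exists (U `&` V); split=> // [|k]; first exact: openI.
apply: CkM; first exact: openI.
- exact: Ck_sub (hU k).
- exact: Ck_sub (hV k).
Qed.

End EuclideanSmoothness.

Section Manifolds.
Context {R : realType}.

(* A homeomorphism from an open set dom of T onto an open set img of R^n.  The
   total functions coord and cinv are junk outside of dom and img. *)
Record chart (T : topologicalType) (n : nat) := Chart {
  dom : set T;
  img : set 'rV[R]_n;
  coord :> T -> 'rV[R]_n;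
  cinv : 'rV[R]_n -> T;
  dom_open : open dom;
  img_open : open img;
  coord_img : forall p, dom p -> img (coord p);
  cinv_dom : forall y, img y -> dom (cinv y);
  coordK : forall p, dom p -> cinv (coord p) = p;
  cinvK : forall y, img y -> coord (cinv y) = y;
  coord_continuous : forall p, dom p -> {for p, continuous coord};
  cinv_continuous : forall y, img y -> {for y, continuous cinv}
}.

Definition compatible (T : topologicalType) n (c d : chart T n) : Prop :=
  forall p, dom c p -> dom d p -> forall i,
    Cinfty_at (fun y => d (cinv c y) 0 i) (c p) /\
    Cinfty_at (fun y => c (cinv d y) 0 i) (d p).

Record manifold (n : nat) := Manifold {
  points :> topologicalType;
  points_hausdorff : hausdorff_space points;
  points_second_countable : @second_countable points;
  atlas : set (chart points n);
  atlas_cover : forall p, exists2 c, atlas c & dom c p;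
  atlas_compatible : forall c d, atlas c -> atlas d -> compatible c d;
  atlas_maximal : forall c,
    (forall d, atlas d -> compatible c d) -> atlas c
}.

(* f is smooth on some neighbourhood of p. *)
Definition smooth_at n (M : manifold n) (f : M -> R) (p : M) : Prop :=
  forall c, atlas c -> dom c p -> Cinfty_at (f \o cinv c) (c p).

(* F pulls smooth germs back to smooth germs.  This implies that F is
   continuous, since functions that are constant near F p are smooth at F p. *)
Definition smooth_map m n (M : manifold m) (N : manifold n) (F : M -> N) :=
  forall p f, smooth_at f (F p) -> smooth_at (f \o F) p.

Section SmoothAt.
Context {n : nat} {M : manifold n}.
Implicit Types (f g : M -> R) (p : M).

Lemma smooth_at_cst (a : R) p : smooth_at (fun=> a) p.
Proof. by move=> c _ _; exact: Cinfty_at_cst. Qed.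

Lemma smooth_atD f g p : smooth_at f p -> smooth_at g p -> smooth_at (f + g) p.
Proof. by move=> hf hg c ac cp; apply: Cinfty_atD; [exact: hf|exact: hg]. Qed.

Lemma smooth_atM f g p : smooth_at f p -> smooth_at g p -> smooth_at (f * g) p.
Proof. by move=> hf hg c ac cp; apply: Cinfty_atM; [exact: hf|exact: hg]. Qed.

Lemma smooth_atZ (a : R) f p : smooth_at f p -> smooth_at (a \*: f) p.
Proof.
by move=> hf; apply: (@smooth_atM (fun=> a)) => //; exact: smooth_at_cst.
Qed.

End SmoothAt.

End Manifolds.

Arguments chart : clear implicits.
Arguments manifold : clear implicits.

Section TangentSpace.
Context {R : realType} {n : nat}.
Variables (M : manifold R n) (p : M).

(* Tangent vectors at p are the derivations of germs at p of smooth functions.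
   A germ is represented by any total function smooth at p; the Leibniz rule
   makes v f depend only on the germ of f (multiply by the indicator function of
   a neighbourhood of p).  The last clause pins down the irrelevant values. *)
Definition derivation_at (v : (M -> R) -> R^o) : Prop :=
  [/\ forall (a : R) f g, smooth_at f p -> smooth_at g p ->
        v (a \*: f + g) = a * v f + v g,
      forall f g, smooth_at f p -> smooth_at g p ->
        v (f * g) = f p * v g + g p * v f &
      forall f, ~ smooth_at f p -> v f = 0].

Definition derivations : {pred ((M -> R) -> R^o)} :=
  fun v => `[< derivation_at v >].

Lemma derivations_submod_closed : submod_closed derivations.
Proof.
split.
  apply/asboolP; split=> //.
  - by move=> a f g _ _; rewrite /GRing.zero/= mulr0 addr0.
  - by move=> f g _ _; rewrite /GRing.zero/= !mulr0 addr0.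
move=> a u v /asboolP[uL uM u0] /asboolP[vL vM v0]; apply/asboolP; split.
- move=> b f g sf sg; rewrite !fctE /= uL// vL//.
  by rewrite /GRing.scale/= !mulrDr addrACA; congr (_ + _ + _ ); rewrite mulrCA.
- move=> f g sf sg; rewrite !fctE /= uM// vM//.
  rewrite /GRing.scale/= !mulrDr addrACA; congr (_ + _ + (_ + _));
  by rewrite mulrCA.
- by move=> f sf; rewrite !fctE /= u0// v0// scaler0 addr0.
Qed.

HB.instance Definition _ :=
  GRing.isSubmodClosed.Build R ((M -> R) -> R^o) derivations
    derivations_submod_closed.

Record tangent := Tangent {
  tangent_fun :> (M -> R) -> R^o;
  tangentP : tangent_fun \in derivations
}.

HB.instance Definition _ := [isSub for tangent_fun].
HB.instance Definition _ := [Choice of tangent by <:].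
HB.instance Definition _ := [SubChoice_isSubLmodule of tangent by <:].

End TangentSpace.

Section Differential.
Context {R : realType} {m n : nat} {M : manifold R m} {N : manifold R n}.
Variables (F : M -> N) (F_smooth : smooth_map F).

Definition pushforward (p : M) (v : tangent p) : (N -> R) -> R^o :=
  fun f => if `[< smooth_at f (F p) >] then v (f \o F) else 0.

Lemma pushforward_derivation p (v : tangent p) :
  pushforward v \in derivations (F p).
Proof.
have /asboolP[vL vM v0] := tangentP v; apply/asboolP; split.
- move=> a f g sf sg.
  have sfg : smooth_at (a \*: f + g) _ := smooth_atD (smooth_atZ a sf) sg.
  rewrite /pushforward !asboolT//.
  by rewrite -vL//; exact: F_smooth.
- move=> f g sf sg; have sfg := smooth_atM sf sg.
  rewrite /pushforward !asboolT//.
  by rewrite (vM (f \o F) (g \o F))//; exact: F_smooth.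
- by move=> f sf; rewrite /pushforward asboolF.
Qed.

Definition differential (p : M) (v : tangent p) : tangent (F p) :=
  Tangent (pushforward_derivation v).

End Differential.

Section PrincipalBundle.
Context {R : realType} {n : nat}.

(* Principal bundle with structure group R^x, locally U x R^x with the group
   acting by multiplication on the second factor.  The values act 0 are
   irrelevant.  In an adapted chart c over a chart a of M, c p = (x^a, t). *)
Record principal_bundle (M : manifold R n) := PrincipalBundle {
  total :> manifold R (n + 1);
  proj : total -> M;
  proj_smooth : smooth_map proj;
  act : R -> total -> total;
  act_smooth : forall s, s != 0 -> smooth_map (act s);
  act1 : forall p, act 1 p = p;
  actM : forall s t p, s != 0 -> t != 0 -> act (s * t) p = act s (act t p);
  proj_act : forall s p, s != 0 -> proj (act s p) = proj p;
  adapted_charts : forall x : M, exists (a : chart R M n)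
      (c : chart R total (n + 1)),
    [/\ atlas a /\ dom a x,
        atlas c /\ dom c = proj @^-1` dom a,
        img c = [set y | img a (lsubmx y) /\ rsubmx y 0 0 != 0],
        forall p, dom c p -> lsubmx (c p) = a (proj p) &
        forall s p, s != 0 -> dom c p ->
          rsubmx (c (act s p)) = s *: rsubmx (c p)]
}.

End PrincipalBundle.

Arguments proj_smooth {R n M} P : rename.
Arguments adapted_charts {R n M} P x : rename.

Section EulerField.
Context {R : realType} {n : nat} {M : manifold R n}.
Variable P : principal_bundle M.

Definition euler_fun (p : P) : (P -> R) -> R^o :=
  fun f => if `[< smooth_at f p >] then derive1 (fun s => f (act s p)) 1 else 0.

Lemma derivable_orbit (p : P) (f : P -> R) : smooth_at f p ->
  derivable (fun s => f (act s p)) 1 1.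
Proof.
move=> sf; have [a [c [[aa ap] [ac dc] _ cl cr]]] := adapted_charts P (proj p).
have cp : dom c p by rewrite dc.
have [_ /(_ (rshift n 0)) df] : C0_derivable (f \o cinv c) (c p).
  have /Cinfty_atP[U [_ Up hU]] := sf c ac cp.
  exact: (hU 0%N [::]).
pose t := rsubmx (c p) 0 0; set e := delta_mx _ _ in df.
have actE s : s != 0 -> act s p = cinv c ((s - 1) * t *: e + c p).
  move=> s0; have cs : dom c (act s p) by rewrite dc /= proj_act.
  rewrite -[LHS](coordK cs); congr cinv.
  rewrite -[LHS]hsubmxK -[RHS]hsubmxK; congr row_mx.
    rewrite cl// proj_act// -cl//; apply/rowP => i.
    rewrite !mxE [_ == _]/= [lshift _ _ == _]eq_lrshift.
    by rewrite andbF mulr0 add0r.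
  rewrite cr//; apply/rowP => i; rewrite !ord1 !mxE !eqxx mulr1 mulrBl mul1r.
  by rewrite /t !mxE subrK.
pose G h := (f \o cinv c) (h *: e + c p).
have dG : derivable G 0 1 := (derivable1P _ _ _).1 df.
pose u (s : R) := (s - 1) * t.
have du : derivable u 1 1.
  have h : derivable (((@id R : R -> R) - cst 1) * cst t) (1 : R) 1.
    apply: derivableM; last exact: derivable_cst.
    by apply: derivableB; [exact: derivable_id|exact: derivable_cst].
  exact: h.
have dGu : derivable (G \o u) 1 1.
  apply/derivable1_diffP; apply: differentiable_comp; first exact/derivable1_diffP.
  by rewrite /u subrr mul0r; exact/derivable1_diffP.
apply: near_eq_derivable dGu.
near=> s; rewrite /= /G /u /= actE//.
by near: s; apply: (@cvgr_neq0 _ _ _ _ _ id (1 : R)); rewrite ?oner_eq0.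
Unshelve. all: by end_near. Qed.

Lemma euler_derivation p : euler_fun p \in derivations p.
Proof.
apply/asboolP; split.
- move=> a f g sf sg.
  have sfg : smooth_at (a \*: f + g) _ := smooth_atD (smooth_atZ a sf) sg.
  rewrite /euler_fun !asboolT//.
  have [df dg] := (derivable_orbit sf, derivable_orbit sg).
  have := deriveD (derivableZ (k := a) df) dg.
  by rewrite (deriveZ a df) !derive1E.
- move=> f g sf sg; have sfg := smooth_atM sf sg.
  rewrite /euler_fun !asboolT//.
  have [df dg] := (derivable_orbit sf, derivable_orbit sg).
  by rewrite !derive1E (deriveM df dg) act1.
- by move=> f sf; rewrite /euler_fun asboolF.
Qed.

(* The fundamental vector field of the action: the velocity at s = 1 of
   s |-> act s p. *)
Definition euler (p : P) : tangent p := Tangent (euler_derivation p).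

Definition vertical (p : P) (v : tangent p) : Prop :=
  differential (proj_smooth P) v = 0.

End EulerField.

Section TensorFields.
Context {R : realType} {n : nat} {M : manifold R n}.

Definition vector_field := forall p : M, tangent p.

(* Local fields are represented by total ones, of which only the germ at p
   matters here. *)
Definition smooth_field_at (X : vector_field) (p : M) : Prop :=
  forall f, smooth_at f p -> smooth_at (fun q => X q f) p.

Definition covariant2 := forall p : M, tangent p -> tangent p -> R.

(* A possibly degenerate metric: a smooth symmetric covariant 2-tensor field.
   Smoothness is tested on local vector fields, which include the coordinate
   fields of any chart. *)
Definition metric_tensor (g : covariant2) : Prop :=
  [/\ forall p v w, g p v w = g p w v,
      forall p (a : R) u v w, g p (a *: u + v) w = a * g p u w + g p v w &
      forall p X Y, smooth_field_at X p -> smooth_field_at Y p ->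
        smooth_at (fun q => g q (X q) (Y q)) p].

Definition nondegenerate_tensor (g : covariant2) : Prop :=
  forall p v, (forall w, g p v w = 0) -> v = 0.

(* Smoothness is not part of the definition; for the connection one-form below
   it follows from the smoothness of the connection. *)
Definition one_form := forall p : M, {scalar tangent p}.

Definition form_square (omega : one_form) : covariant2 :=
  fun p v w => omega p v * omega p w.

(* Fibrewise linear maps over the identity are smooth as maps TM -> TM exactly
   when they send smooth local vector fields to smooth local vector fields. *)
Definition smooth_bundle_map
    (Phi : forall p : M, {linear tangent p -> tangent p}) : Prop :=
  forall p X, smooth_field_at X p -> smooth_field_at (fun q => Phi q (X q)) p.

End TensorFields.

Arguments covariant2 {R n} M.
Arguments one_form {R n} M.
Arguments form_square {R n M} omega p v w.

Section Carroll.
Context {R : realType} {n : nat} {M : manifold R n}.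
Variable P : principal_bundle M.

Definition carrollian (g : covariant2 P) : Prop :=
  metric_tensor g /\ forall p v, (forall w, g p v w = 0) <-> vertical (p := p) v.

Definition connection (Phi : forall p : P, {linear tangent p -> tangent p}) :=
  [/\ smooth_bundle_map Phi,
      forall p v, Phi p (Phi p v) = Phi p v,
      forall p v, (exists w, Phi p w = v) <-> vertical v &
      forall s (s0 : s != 0) p (v : tangent p),
        differential (act_smooth s0) (Phi p v) =
        Phi (act s p) (differential (act_smooth s0) v)].

Definition connection_form
    (Phi : forall p : P, {linear tangent p -> tangent p})
    (omega : one_form P) : Prop :=
  forall p v, Phi p v = omega p v *: euler p.

End Carroll.

(* Main.v *)
Require Import Defs.
From mathcomp Require Import all_boot all_order all_algebra.
From mathcomp Require Import all_classical all_reals all_analysis.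

Set Implicit Arguments.
Unset Strict Implicit.

Import GRing.Theory.
Import numFieldNormedType.Exports.
Local Open Scope classical_set_scope.
Local Open Scope ring_scope.

(** The vertical line at p is spanned by the Euler vector E, so a vertical v
    satisfies v = Phi v = omega(v) E.  Let e be a nonzero scalar and let v lie in
    the kernel of g + e omega^2.  Pairing v with E kills the g-term, because E is
    vertical and hence in the kernel of g, and leaves e omega(v) omega(E) = 0.
    As Phi E = E and E does not vanish, omega(E) = 1; so omega(v) = 0.  The
    omega-term has now disappeared for every second argument, so v is in the
    kernel of g, that is vertical, and v = omega(v) E = 0
    ([carrollian_perturb_nondegenerate]).

    Both the nonvanishing of E and the smoothness of omega come from the fibre
    coordinate t of an adapted chart.  It is smooth, nowhere zero, and E t = t
    ([euler_fiber_coord]).  Applying Phi X = omega(X) E to t gives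
    omega(X) = t^-1 (Phi X)(t), which is smooth whenever X is, since Phi
    preserves smooth fields and the inverse of a nonvanishing smooth function is
    smooth ([connection_form_smooth]). *)

(** * Smooth functions: locality, inverses and coordinates *)

Lemma Cinfty_at_near_eq {R : realType} {n} (f g : 'rV[R]_n -> R) x :
  {near x, f =1 g} -> Cinfty_at f x -> Cinfty_at g x.
Proof.
rewrite {1}/prop_near1 nbhsE => -[V [oV Vx] fg] /Cinfty_atP[U [oU Ux hU]].
apply/Cinfty_atP; exists (U `&` V); split=> // [|k]; first exact: openI.
apply: (Ck_ext (f := f)) (openI oU oV) _ _ => [z [_ /fg]//|].
by apply: Ck_sub (hU k) => z [].
Qed.

Lemma smooth_at_near_eq {R : realType} {n} (M : manifold R n) (f g : M -> R) p :
  {near p, f =1 g} -> smooth_at f p -> smooth_at g p.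
Proof.
move=> fg sf c ac cp; apply: Cinfty_at_near_eq (sf c ac cp).
have cc : {for c p, continuous (cinv c)}.
  exact/cinv_continuous/coord_img.
have fg' : nbhs (cinv c (c p)) [set q | f q = g q] by rewrite coordK.
exact: cc _ fg'.
Qed.

Lemma C0_derivableV {R : realType} {n} (f : 'rV[R]_n -> R) y : f y != 0 ->
  C0_derivable f y -> C0_derivable (fun z => (f z)^-1) y.
Proof.
move=> fy [cf df]; split=> [|i]; first exact: continuousV.
exact: derivableV.
Qed.

(** Induction on k: the partial derivatives of f^-1 are the products
    - f^-1 f^-1 (partial f i), in which f^-1 itself has one order less. *)
Lemma CkV {R : realType} {n} k (U : set 'rV[R]_n) f : open U ->
  (forall y, U y -> f y != 0) -> Ck k U f -> Ck k U (fun y => (f y)^-1).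
Proof.
move=> oU f0; elim: k => [|k IH].
  by rewrite !Ck0 => hf y Uy; apply: C0_derivableV; [exact: f0|exact: hf].
move=> hf; have fVk := IH (CkW hf); move: hf; rewrite !CkS => -[fd fS].
split=> [y Uy|i]; first by apply: C0_derivableV; [exact: f0|exact: fd].
have h := CkM oU (Ck_cst (k := k) (-1) oU) (CkM oU (CkM oU fVk fVk) (fS i)).
apply: Ck_ext oU _ h => z Uz; have [_ df] := fd z Uz.
rewrite /partial (deriveV (f0 z Uz) (df i)).
by rewrite !fctE /GRing.scale/= mulN1r mulNr expr2 invfM.
Qed.

Lemma Cinfty_atV {R : realType} {n} (f : 'rV[R]_n -> R) x : f x != 0 ->
  Cinfty_at f x -> Cinfty_at (fun y => (f y)^-1) x.
Proof.
move=> fx /Cinfty_atP[U [oU Ux hU]].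
have [cf _] : C0_derivable f x := hU 0%N [::] isT x Ux.
have : nbhs x [set y | f y != 0] by exact: cvgr_neq0 cf fx.
rewrite nbhsE => -[V [oV Vx] V0].
apply/Cinfty_atP; exists (U `&` V); split=> // [|k]; first exact: openI.
apply: CkV (openI oU oV) _ _ => [y [_ /V0]//|].
by apply: Ck_sub (hU k) => z [].
Qed.

Lemma smooth_atV {R : realType} {n} (M : manifold R n) (f : M -> R) p :
  f p != 0 -> smooth_at f p -> smooth_at (fun q => (f q)^-1) p.
Proof.
by move=> fp sf c ac cp; apply: Cinfty_atV (sf c ac cp); rewrite /= coordK.
Qed.

Lemma smooth_at_coord {R : realType} {n} (M : manifold R n) (c : chart R M n)
    i p : atlas c -> dom c p -> smooth_at (fun q => c q 0 i) p.
Proof.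
by move=> ac cp d ad dp; have [_] := atlas_compatible ac ad cp dp i.
Qed.

(** * The Euler vector field *)

Lemma euler_vertical {R : realType} {n} {M : manifold R n}
  (P : principal_bundle M) (p : P) : vertical (euler p).
Proof.
rewrite /vertical; apply: val_inj; apply/funext => f /=; rewrite /Defs.pushforward.
have [sf|nsf] := pselect (smooth_at f (Defs.proj p)); last by rewrite asboolF.
rewrite asboolT//= /euler_fun asboolT; last exact: proj_smooth.
(* The value of the action at 0 is arbitrary, so the orbit stays in its fibre
   only for s near 1. *)
rewrite derive1E; have -> : 'D_1 (fun s => (f \o @Defs.proj _ _ _ P) (act s p)) (1 : R)
    = 'D_1 (cst (f (Defs.proj p))) (1 : R).
  apply: near_eq_derive; near=> s; rewrite /= proj_act//.
  by near: s; apply: (@cvgr_neq0 _ _ _ _ _ id (1 : R)); rewrite ?oner_eq0.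
exact: derive_cst.
Unshelve. all: by end_near. Qed.

(** The coordinate t is equivariant, so the orbit curve s |-> t (act s p) is
    s |-> s * t p, whose velocity at 1 is t p. *)
Lemma euler_fiber_coord {R : realType} {n} {M : manifold R n}
    (P : principal_bundle M) (p : P) :
  exists t : P -> R, \forall q \near p,
    [/\ t q != 0, smooth_at t q & euler q t = t q].
Proof.
have [a [c [[_ ap] [ac dc] ic _ cr]]] := adapted_charts P (Defs.proj p).
exists (fun q => c q 0 (rshift n 0)).
have : nbhs p (dom c).
  by apply: open_nbhs_nbhs; split; [exact: dom_open|rewrite dc].
apply: filterS => q cq; have sq := smooth_at_coord (rshift n 0) ac cq.
split=> //.
  by have := coord_img cq; rewrite ic /= => -[_]; rewrite mxE.
rewrite /= /euler_fun asboolT// derive1E.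
set t := c q 0 (rshift n 0).
have -> : 'D_1 (fun s => c (act s q) 0 (rshift n 0)) (1 : R)
    = 'D_1 ((@id R : R -> R) * cst t) (1 : R).
  apply: near_eq_derive; near=> s; have s0 : s != 0.
    by near: s; apply: (@cvgr_neq0 _ _ _ _ _ id (1 : R)); rewrite ?oner_eq0.
  by have /rowP/(_ 0) := cr s q s0 cq; rewrite !mxE.
rewrite deriveM; [|exact: derivable_id|exact: derivable_cst].
by rewrite derive_id derive_cst /GRing.scale/= mulr0 add0r mulr1.
Unshelve. all: by end_near. Qed.

Lemma euler_neq0 {R : realType} {n} {M : manifold R n}
  (P : principal_bundle M) (p : P) : euler p != 0.
Proof.
have [t /nbhs_singleton[t0 _ Et]] := euler_fiber_coord p.
by apply: contraNneq t0 => E0; rewrite -Et E0.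
Qed.

(** * The connection one-form *)

Lemma connection_form_euler {R : realType} {n} {M : manifold R n}
    (P : principal_bundle M) (Phi : forall p : P, {linear tangent p -> tangent p})
    (omega : one_form P) (p : P) :
  connection Phi -> connection_form Phi omega -> omega p (euler p) = 1.
Proof.
move=> [_ idem im _] om; have [w Ew] := (im p _).2 (euler_vertical p).
have := idem p w; rewrite Ew om -[X in _ = X]scale1r => /eqP.
rewrite -subr_eq0 -scalerBl scaler_eq0 (negbTE (euler_neq0 p)) orbF subr_eq0.
by move/eqP.
Qed.

Lemma vertical_connection_form {R : realType} {n} {M : manifold R n}
    (P : principal_bundle M) (Phi : forall p : P, {linear tangent p -> tangent p})
    (omega : one_form P) (p : P) (v : tangent p) :
  connection Phi -> connection_form Phi omega ->
  vertical v -> v = omega p v *: euler p.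
Proof. by move=> [_ idem im _] om /im[w <-]; rewrite -om idem. Qed.

Lemma connection_form_smooth {R : realType} {n} {M : manifold R n}
    (P : principal_bundle M) (Phi : forall p : P, {linear tangent p -> tangent p})
    (omega : one_form P) (p : P) (X : vector_field (M := P)) :
  connection Phi -> connection_form Phi omega -> smooth_field_at X p ->
  smooth_at (fun q => omega q (X q)) p.
Proof.
move=> [sPhi _ _ _] om sX; have [t tP] := euler_fiber_coord p.
have [t0 st _] := nbhs_singleton tP.
apply: smooth_at_near_eq (smooth_atM (sPhi p X sX t st) (smooth_atV t0 st)).
apply: filterS tP => q [tq _ Eq].
have Et : Phi q (X q) t = omega q (X q) * t q by rewrite om -[in RHS]Eq.
by change (Phi q (X q) t * (t q)^-1 = omega q (X q)); rewrite Et mulfK.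
Qed.

(** * Rank-one perturbations of a Carrollian metric *)

Lemma form_square_metric {R : realType} {n} {M : manifold R n}
    (omega : one_form M) :
  (forall p X, smooth_field_at X p -> smooth_at (fun q => omega q (X q)) p) ->
  metric_tensor (form_square omega).
Proof.
move=> so; split=> [p v w|p a u v w|p X Y sX sY]; rewrite /form_square.
- exact: mulrC.
- by rewrite linearP mulrDl mulrA.
- exact: smooth_atM (so p X sX) (so p Y sY).
Qed.

Lemma metric_tensorDZ {R : realType} {n} {M : manifold R n}
    (g h : covariant2 M) (e : R) : metric_tensor g -> metric_tensor h ->
  metric_tensor (fun p v w => g p v w + e * h p v w).
Proof.
move=> [gC gL gS] [hC hL hS]; split=> [p v w|p a u v w|p X Y sX sY].
- by rewrite gC hC.
- by rewrite gL hL !mulrDr addrACA mulrCA.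
- exact: smooth_atD (gS p X Y sX sY) (smooth_atZ e (hS p X Y sX sY)).
Qed.

Lemma carrollian_perturb_nondegenerate {R : realType} {n} {M : manifold R n}
    (P : principal_bundle M) (g : covariant2 P)
    (Phi : forall p : P, {linear tangent p -> tangent p})
    (omega : one_form P) (e : R) : e != 0 ->
  carrollian g -> connection Phi -> connection_form Phi omega ->
  nondegenerate_tensor (fun p v w => g p v w + e * form_square omega p v w).
Proof.
move=> e0 [[gC _ _] gker] cPhi om p v kv.
have ov : omega p v = 0.
  have /eqP := kv (euler p); rewrite gC (gker p _).2; last exact: euler_vertical.
  rewrite add0r /form_square (connection_form_euler p cPhi om) mulr1 mulf_eq0.
  by rewrite (negbTE e0) => /eqP.
have vv : vertical v.
  by apply/gker => w; have := kv w; rewrite /form_square ov mul0r mulr0 addr0.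
by rewrite (vertical_connection_form cPhi om vv) ov scale0r.
Qed.

Lemma carrollian_perturb {R : realType} {n} {M : manifold R n}
    (P : principal_bundle M) (g : covariant2 P)
    (Phi : forall p : P, {linear tangent p -> tangent p})
    (omega : one_form P) (e : R) : e != 0 ->
  carrollian g -> connection Phi -> connection_form Phi omega ->
  metric_tensor (fun p v w => g p v w + e * form_square omega p v w) /\
  nondegenerate_tensor (fun p v w => g p v w + e * form_square omega p v w).
Proof.
move=> e0 cg cPhi om; split; last exact: carrollian_perturb_nondegenerate cg cPhi om.
apply: metric_tensorDZ; first by case: cg.
by apply: form_square_metric => p X; exact: connection_form_smooth cPhi om.
Qed.

Theorem proposition3p21 (R : realType) (n : nat) (M : manifold R n)
    (P : principal_bundle M) (g : covariant2 P)
    (Phi : forall p : P, {linear tangent p -> tangent p})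
    (omega : one_form P) :
  carrollian g -> connection Phi -> connection_form Phi omega ->
  (metric_tensor (fun p v w => g p v w + form_square omega p v w) /\
   nondegenerate_tensor (fun p v w => g p v w + form_square omega p v w)) /\
  (metric_tensor (fun p v w => g p v w - form_square omega p v w) /\
   nondegenerate_tensor (fun p v w => g p v w - form_square omega p v w)).
Proof.
move=> cg cPhi om.
have gD : (fun p v w => g p v w + form_square omega p v w) =
    (fun p v w => g p v w + 1 * form_square omega p v w).
  by do 3![apply: functional_extensionality_dep => ?]; rewrite mul1r.
have gB : (fun p v w => g p v w - form_square omega p v w) =
    (fun p v w => g p v w + -1 * form_square omega p v w).
  by do 3![apply: functional_extensionality_dep => ?]; rewrite mulN1r.
by rewrite gD gB; split; apply: carrollian_perturb cg cPhi om;
  rewrite ?oppr_eq0 oner_eq0.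
Qed.
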